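(* Let $\mathbb{F}$ be a perfect field of characteristic $p>0$, and let $R=\bigoplus_{n\in\mathbb{N}}R_n$ be a commutative Noetherian graded ring with $R_0=\mathbb{F}$, equipped with a graded Frobenius splitting $\varphi:R\to R$. Let $f$ be a Hilbert polynomial. Then the set of compatibly split saturated graded ideals $I\le R$ with Hilbert polynomial $h_I=f$ is a finite subset of the Hilbert scheme $H_f(R)$.
   Context: A Frobenius splitting of a commutative Noetherian ring $R\supseteq\mathbb{F}$ is a map $\varphi:R\to R$ with $\varphi(a+b)=\varphi(a)+\varphi(b)$, $\varphi(a^pb)=a\varphi(b)$ for all $a,b\in R$, and $\varphi(1)=1$. It is a graded splitting if $\varphi(R_k)=0$ whenever $p\nmid k$, and $\varphi(R_k)\subseteq R_{k/p}$ whenever $p\mid k$. An ideal $I\le R$ is compatibly split if $\varphi(I)\subseteq I$. The Hilbert polynomial of a graded ideal $I\le R$ is the unique polynomial $h_I$ with $h_I(n)=\dim_{\mathbb{F}}(R/I)_n$ for all sufficiently divisible $n$. Saturated means saturated with respect to the irrelevant ideal $\bigoplus_{n>0}R_n$. The Hilbert scheme $H_f(R)$ represents the functor of saturated graded ideals $I\le R$ with $h_I=f$. *)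

(* Defs.v *)
From mathcomp Require Import all_boot all_order all_algebra.
From mathcomp Require Import all_classical.

Set Implicit Arguments.
Unset Strict Implicit.
Unset Printing Implicit Defensive.

Import GRing.Theory.
Local Open Scope classical_set_scope.
Local Open Scope ring_scope.

Definition perfect_field_of_char (F : fieldType) (p : nat) : Prop :=
  p \in [pchar F] /\ forall x : F, exists y : F, y ^+ p = x.

Section Ideals.
Variable R : comNzRingType.
Implicit Types I J : set R.

(* Unlike [idealr_closed], this admits the unit ideal. *)
Definition is_ideal I : Prop :=
  [/\ I 0, (forall x y, I x -> I y -> I (x + y))
    & (forall a x, I x -> I (a * x))].

Definition ideal_gen (S : set R) : set R := smallest is_ideal S.

Definition ideal_mul I J : set R :=
  ideal_gen [set z | exists x y, [/\ I x, J y & z = x * y]].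

Definition ideal_exp I (k : nat) : set R := iter k (ideal_mul I) setT.

Definition noetherian : Prop :=
  forall I, is_ideal I -> exists s : seq R, I = ideal_gen [set` s].

Definition frobenius_splitting (p : nat) (phi : R -> R) : Prop :=
  [/\ forall a b, phi (a + b) = phi a + phi b,
      forall a b, phi (a ^+ p * b) = a * phi b
    & phi 1 = 1].

Definition compatibly_split (phi : R -> R) I : Prop := phi @` I `<=` I.

End Ideals.

Section Graded.
Variables (F : fieldType) (R : comAlgType F) (gr : nat -> set R).
Implicit Types I : set R.

(* [gr n] is the piece R_n; the last two fields say that R is the (internal)
   direct sum of the R_n. *)
Record is_grading : Prop := IsGrading {
  grading_submod : forall n, gr n 0 /\
    forall (a : F) x y, gr n x -> gr n y -> gr n (a *: x + y);
  grading_mul : forall m n x y, gr m x -> gr n y -> gr (m + n)%N (x * y);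
  grading_zero : gr 0%N = range (fun a : F => a%:A);
  grading_span : forall x, exists (c : nat -> R) (N : nat),
    (forall n, gr n (c n)) /\ x = \sum_(n < N) c n;
  grading_free : forall (c : nat -> R) (N : nat), (forall n, gr n (c n)) ->
    \sum_(n < N) c n = 0 -> forall n : 'I_N, c n = 0 }.

Definition graded_ideal I : Prop :=
  is_ideal I /\
  forall (c : nat -> R) (N : nat), (forall n, gr n (c n)) ->
    I (\sum_(n < N) c n) -> forall n : 'I_N, I (c n).

Definition irrelevant_ideal : set R :=
  [set x | exists (c : nat -> R) (N : nat),
     (forall n, gr n.+1 (c n)) /\ x = \sum_(n < N) c n].

(* I : m^oo, the union of the colon ideals I : m^k. *)
Definition saturation I : set R :=
  [set x | exists k, forall y, ideal_exp irrelevant_ideal k y -> I (y * x)].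

Definition saturated I : Prop := saturation I = I.

(* dim_F (V / (V `&` W)) = d: some d elements of V form a basis of V modulo W.
   For a graded ideal I, (R/I)_n = R_n / (R_n `&` I). *)
Definition quot_dim (V W : set R) (d : nat) : Prop :=
  exists b : 'I_d -> R,
    [/\ forall i, V (b i),
        forall x, V x -> exists a : 'I_d -> F, W (x - \sum_i a i *: b i)
      & forall a : 'I_d -> F, W (\sum_i a i *: b i) -> forall i, a i = 0].

(* h_I = f. Degree 0 is excluded: 0 is a multiple of every N, but "sufficiently
   divisible" refers to positive degrees. Two polynomials satisfying this for
   the same I agree at infinitely many integers, hence are equal. *)
Definition has_hilbert_poly I (f : {poly rat}) : Prop :=
  exists2 N : nat, (0 < N)%N &
    forall n, (0 < n)%N -> (N %| n)%N ->
      exists2 d, quot_dim (gr n) I d & f.[n%:R] = d%:R.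

(* The F-points of the Hilbert scheme H_f(R). *)
Definition hilbert_points (f : {poly rat}) : set (set R) :=
  [set I | [/\ graded_ideal I, saturated I & has_hilbert_poly I f]].

Definition graded_splitting (p : nat) (phi : R -> R) : Prop :=
  [/\ frobenius_splitting p phi,
      forall k x, ~~ (p %| k)%N -> gr k x -> phi x = 0
    & forall k x, (p %| k)%N -> gr k x -> gr (k %/ p)%N (phi x)].

End Graded.

(* Main.v *)
Require Import Defs.
From mathcomp Require Import all_boot all_order all_algebra.
From mathcomp Require Import all_classical.
From mathcomp Require Import ring.

Import GRing.Theory.
Local Open Scope classical_set_scope.
Local Open Scope ring_scope.

(** A Noetherian ring [R] of characteristic [p] that is a finite module over the
    subring of its [p]-th powers has only finitely many ideals compatible with a
    given splitting [phi] ([finite_split_ideals]). A Noetherian graded ring with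
    [R_0 = F] perfect is such a ring: it is a finitely generated [F]-algebra, and
    the monomials in the generators with exponents below [p] span it over the
    [p]-th powers ([graded_pspan]).

    The finiteness is a Noetherian induction. Compatibly split ideals are
    radical, and they are stable under sums, intersections and colons. Suppose
    that infinitely many of them contain [J], and take [J] compatibly split and
    maximal with this property. If [x * y] lies in [J] while [x] and [y] do not,
    set [J1 = J : x] and [J2 = J : J1]; both are larger than [J], so only finitely
    many compatibly split ideals contain either of them. But each such ideal [I]
    above [J] is recovered as [(I + J1) /\ (I + J2)] ([rad_meet_add]), so there
    are only finitely many [I], a contradiction. Hence [J] is prime.

    For a prime [J], the pairing [(x, y) |-> phi (x * y)] on the fraction field of
    [R / J] is nondegenerate, and its dual bases have a common denominator: there
    are [c] outside [J] and finitely many [b_i], [d_i] with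
    [c ^+ p * x = \sum_i phi (x * d_i) ^+ p * b_i] modulo [J], for all [x]
    ([dual_family]). If [x] is in a compatibly split [I] above [J], so is every
    [phi (x * d_i)]; thus [c ^+ p * I] lies in [I ^ 2 + J]. When [I] is not [J],
    Nakayama's determinant trick puts a power of [c] in [I], and then [c ^+ p]
    itself, as [I] is radical ([test_element]). So all compatibly split ideals
    strictly above [J] contain one and the same element outside [J]. Their
    intersection is compatibly split and larger than [J], and by maximality only
    finitely many lie above it: the final contradiction. *)

(** * Ideals and their generators *)

Section IdealTheory.
Set Implicit Arguments.
Unset Strict Implicit.
Unset Printing Implicit Defensive.
Variable R : comNzRingType.
Implicit Types (I J S : set R) (s t : seq R).

Lemma ideal0 I : is_ideal I -> I 0.
Proof. by case. Qed.

Lemma idealD I x y : is_ideal I -> I x -> I y -> I (x + y).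
Proof. by case=> _ + _; apply. Qed.

Lemma idealM I a x : is_ideal I -> I x -> I (a * x).
Proof. by case=> _ _; apply. Qed.

Lemma idealMr I a x : is_ideal I -> I x -> I (x * a).
Proof. by rewrite mulrC; apply: idealM. Qed.

Lemma idealN I x : is_ideal I -> I x -> I (- x).
Proof. by move=> iI Ix; rewrite -mulN1r; apply: idealM. Qed.

Lemma idealB I x y : is_ideal I -> I x -> I y -> I (x - y).
Proof. by move=> iI Ix Iy; apply: idealD => //; apply: idealN. Qed.

Lemma ideal_subK I x y : is_ideal I -> I (x - y) -> I y -> I x.
Proof. by move=> iI Ixy Iy; rewrite -(subrK y x); apply: idealD. Qed.

Lemma ideal_sum I (T : Type) (r : seq T) (P : pred T) (G : T -> R) :
  is_ideal I -> (forall i, P i -> I (G i)) -> I (\sum_(i <- r | P i) G i).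
Proof.
move=> iI IG; apply: (big_ind I) => //; first exact: ideal0.
by move=> x y; apply: idealD.
Qed.

Lemma ideal_gen_ideal S : is_ideal (ideal_gen S).
Proof.
split=> [I [] /ideal0 //|x y Sx Sy I SI|a x Sx I SI].
  by apply: idealD (Sx _ SI) (Sy _ SI); case: SI.
by apply: idealM (Sx _ SI); case: SI.
Qed.

Lemma ideal_gen_min S I : is_ideal I -> S `<=` I -> ideal_gen S `<=` I.
Proof. exact: smallest_sub. Qed.

Lemma mem_ideal_gen S : S `<=` ideal_gen S.
Proof. exact: sub_smallest. Qed.

Lemma ideal_gen_seqP s x :
  ideal_gen [set` s] x -> exists r : 'I_(size s) -> R, x = \sum_i r i * s`_i.
Proof.
move: x; apply: ideal_gen_min => [|x /= xs]; last first.
  have lt_xs : (index x s < size s)%N by rewrite index_mem.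
  exists (fun i => (i == Ordinal lt_xs)%:R).
  rewrite (bigD1 (Ordinal lt_xs)) //= eqxx mul1r nth_index // big1 ?addr0 //.
  by move=> i /negPf ->; rewrite mul0r.
split.
- by exists (fun _ => 0); rewrite big1 // => i _; rewrite mul0r.
- move=> _ _ [r1 ->] [r2 ->]; exists (fun i => r1 i + r2 i).
  by rewrite -big_split /=; apply: eq_bigr => i _; rewrite mulrDl.
- move=> a _ [r ->]; exists (fun i => a * r i).
  by rewrite big_distrr /=; apply: eq_bigr => i _; rewrite mulrA.
Qed.

Lemma zero_ideal : is_ideal [set (0 : R)].
Proof.
split=> // [x y /= -> ->|a x /= ->]; first by rewrite addr0.
by rewrite mulr0.
Qed.

Lemma bigcap_ideal (P : set (set R)) :
  P `<=` (@is_ideal R) -> is_ideal (\bigcap_(I in P) I).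
Proof.
move=> idP; split=> [I /idP/ideal0 //|x y Px Py I PI|a x Px I PI].
  exact: idealD (idP _ PI) (Px _ PI) (Py _ PI).
exact: idealM (idP _ PI) (Px _ PI).
Qed.

Definition ideal_add I J : set R := [set x + y | x in I & y in J].

Lemma ideal_addl I J : is_ideal J -> I `<=` ideal_add I J.
Proof. by move=> /ideal0 J0 x Ix; exists x => //; exists 0; rewrite ?addr0. Qed.

Lemma ideal_addr I J : is_ideal I -> J `<=` ideal_add I J.
Proof. by move=> /ideal0 I0 x Jx; exists 0 => //; exists x; rewrite ?add0r. Qed.

Lemma ideal_add_ideal I J : is_ideal I -> is_ideal J -> is_ideal (ideal_add I J).
Proof.
move=> iI iJ; split.
- by apply: ideal_addl => //; apply: ideal0.
- move=> _ _ [x Ix [y Jy <-]] [x' Ix' [y' Jy' <-]].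
  by exists (x + x'); [apply: idealD|exists (y + y'); [apply: idealD|ring]].
- move=> a _ [x Ix [y Jy <-]].
  by exists (a * x); [apply: idealM|exists (a * y); [apply: idealM|ring]].
Qed.

Definition colon J S : set R := [set z | forall w, S w -> J (z * w)].

Lemma colon_ideal J S : is_ideal J -> is_ideal (colon J S).
Proof.
move=> iJ; split=> [w _|x y Cx Cy w Sw|a x Cx w Sw].
- by rewrite mul0r; apply: ideal0.
- by rewrite mulrDl; apply: idealD; [|apply: Cx|apply: Cy].
- by rewrite -mulrA; apply: idealM => //; apply: Cx.
Qed.

Lemma sub_colon J S : is_ideal J -> J `<=` colon J S.
Proof. by move=> iJ x Jx w _; apply: idealMr. Qed.

(** * Prime ideals and the Noetherian condition *)

Definition prime_ideal J : Prop :=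
  [/\ is_ideal J, ~ J 1 & forall x y, J (x * y) -> J x \/ J y].

Lemma prime_idealX J x n : prime_ideal J -> ~ J x -> ~ J (x ^+ n).
Proof.
move=> [_ J1 Jp] Jx; elim: n => [//|n IHn]; rewrite exprS.
by case/Jp.
Qed.

(** Each member of a finite generating set of the ideal spanned by [S] is a
    combination of finitely many elements of [S]; collect these. The point is
    to choose generators inside [S], such as homogeneous ones. *)
Lemma noetherian_gen S : noetherian R ->
  exists2 t : seq R, [set` t] `<=` S & ideal_gen S `<=` ideal_gen [set` t].
Proof.
move=> /(_ _ (ideal_gen_ideal S)) [s Es].
have finS x : ideal_gen S x ->
    exists2 t : seq R, [set` t] `<=` S & ideal_gen [set` t] x.
  move: x; apply: ideal_gen_min => [|x Sx]; last first.
    by exists [:: x] => [y /= /[!inE] /eqP ->//|];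
      apply: mem_ideal_gen; rewrite /= mem_head.
  split.
  - by exists [::] => //; apply: ideal0 (ideal_gen_ideal _).
  - move=> x y [t tS tx] [u uS uy]; exists (t ++ u).
      by move=> z /=; rewrite mem_cat => /orP[/tS|/uS].
    apply: idealD (ideal_gen_ideal _) _ _.
      apply: ideal_gen_min tx; first exact: ideal_gen_ideal.
      by move=> z /= zt; apply: mem_ideal_gen; rewrite /= mem_cat zt.
    apply: ideal_gen_min uy; first exact: ideal_gen_ideal.
    by move=> z /= zu; apply: mem_ideal_gen; rewrite /= mem_cat zu orbT.
  - move=> a x [t tS tx]; exists t => //.
    exact: idealM (ideal_gen_ideal _) tx.
suff [t tS st] : exists2 t : seq R, [set` t] `<=` S &
    [set` s] `<=` ideal_gen [set` t].
  by exists t => //; rewrite Es; apply: ideal_gen_min st; apply: ideal_gen_ideal.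
have {Es} : [set` s] `<=` ideal_gen S by rewrite Es; apply: mem_ideal_gen.
elim: s => [|x s IHs] sS; first by exists [::].
have [t tS st] : exists2 t : seq R, [set` t] `<=` S &
    [set` s] `<=` ideal_gen [set` t].
  by apply: IHs => y /= ys; apply: sS; rewrite /= inE ys orbT.
have [u uS ux] : exists2 u : seq R, [set` u] `<=` S & ideal_gen [set` u] x.
  by apply: finS; apply: sS; rewrite /= mem_head.
have mono v : {subset v <= u ++ t} ->
    ideal_gen [set` v] `<=` ideal_gen [set` u ++ t].
  move=> vut; apply: ideal_gen_min; first exact: ideal_gen_ideal.
  by move=> z /= /vut zut; apply: mem_ideal_gen.
exists (u ++ t) => [z /=|z /=]; first by rewrite mem_cat => /orP[/uS|/tS].
rewrite inE => /orP[/eqP ->|/st].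
  by apply: mono ux => y yu; rewrite mem_cat yu.
by apply: mono => y yt; rewrite mem_cat yt orbT.
Qed.

(** Ideals satisfy the ascending chain condition: the union of a chain is
    generated by finitely many elements, all of which lie in one member. *)
Lemma noetherian_max (P : set (set R)) I0 : noetherian R ->
  P `<=` (@is_ideal R) -> P I0 ->
  exists2 J, P J & forall I, P I -> J `<=` I -> I = J.
Proof.
move=> noethR idP PI0.
(* The empty chain has an empty union, so the empty set joins the poset. *)
pose Q := P `|` [set set0].
have [F FQ totF|J [QJ maxJ]] := @Zorn_bigcup _ Q; last first.
  have {}QJ : P J.
    case: QJ => // J0; have [] := maxJ I0; last by left.
    rewrite J0; split; first exact: sub0set.
    by move=> /(_ 0 (ideal0 (idP _ PI0))).
  exists J => // I PI JI; apply: contrapT => neIJ; apply: (maxJ I); last by left.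
  by split=> // IJ; apply: neIJ; apply/seteqP.
have [->|/set0P[x0 [X0 FX0 X0x0]]] := eqVneq (\bigcup_(X in F) X) set0.
  by right.
left; set U := \bigcup_(X in F) X.
have FP X x : F X -> X x -> P X by move=> /FQ[//|->].
have idU : is_ideal U.
  split.
  - by exists X0 => //; apply: ideal0 (idP _ (FP _ _ FX0 X0x0)).
  - move=> x y [X FX Xx] [Y FY Yy].
    have [XY|YX] := totF _ _ FX FY.
      exists Y => //; exact: idealD (idP _ (FP _ _ FY Yy)) (XY _ Xx) Yy.
    exists X => //; exact: idealD (idP _ (FP _ _ FX Xx)) Xx (YX _ Yy).
  - move=> a x [X FX Xx]; exists X => //.
    exact: idealM (idP _ (FP _ _ FX Xx)) Xx.
have [s Us] := noethR _ idU.
have [X FX [x Xx sX]] : exists2 X, F X & exists2 x, X x & [set` s] `<=` X.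
  have : [set` s] `<=` U by rewrite Us; apply: mem_ideal_gen.
  elim: s {Us} => [_|a s IHs sU]; first by exists X0 => //; exists x0.
  have [y /= ys|X FX [x Xx sX]] := IHs.
    by apply: sU; rewrite /= inE ys orbT.
  have [Y FY Ya] : U a by apply: sU; rewrite /= mem_head.
  have [XY|YX] := totF _ _ FX FY.
    exists Y => //; exists a => // y /=.
    by rewrite inE => /orP[/eqP ->|/sX/XY].
  exists X => //; exists x => // y /=.
  by rewrite inE => /orP[/eqP ->|/sX//]; apply: YX.
suff -> : U = X by apply: FP Xx.
apply/seteqP; split; last by move=> y Xy; exists X.
by rewrite Us; apply: ideal_gen_min sX; apply: idP (FP _ _ FX Xx).
Qed.

End IdealTheory.

(** * Finite generation over the subring of p-th powers *)

Section Splitting.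
Set Implicit Arguments.
Unset Strict Implicit.
Unset Printing Implicit Defensive.
Variables (R : comNzRingType) (p : nat).
Hypothesis charR : p \in [pchar R].
Implicit Types (I J : set R) (s ms : seq R).

Let p_pr : prime p := pcharf_prime charR.
Let p_gt1 : (1 < p)%N := prime_gt1 p_pr.

Lemma frobD (x y : R) : (x + y) ^+ p = x ^+ p + y ^+ p.
Proof. by rewrite exprDn_pchar // (pnatE _ p_pr). Qed.

Lemma frob0 : 0 ^+ p = 0 :> R.
Proof. by rewrite expr0n; case: p p_gt1. Qed.

(** Since [p >= 2], the [p]-th power of an element of [I] lies in [I ^ 2]; the two
    factors [x] are isolated for that purpose. *)
Lemma exprp_gt1 (x : R) : x ^+ p = x ^+ p.-2 * x * x.
Proof. by rewrite -!exprSr; congr (_ ^+ _); case: p p_gt1 => [|[]]. Qed.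

(** The [R^p]-submodule generated by [ms]. The recursion exposes one generator
    at a time, which is how a dual family is built. *)
Fixpoint pspan ms : set R :=
  if ms is m :: ms' then
    [set x | exists a y, pspan ms' y /\ x = a ^+ p * m + y]
  else [set 0].

Lemma pspan0 ms : pspan ms 0.
Proof.
elim: ms => [//|m ms IHms] /=; exists 0, 0; split=> //.
by rewrite frob0 mul0r addr0.
Qed.

Lemma pspanD ms x y : pspan ms x -> pspan ms y -> pspan ms (x + y).
Proof.
elim: ms x y => [|m ms IHms] x y /=; first by move=> -> ->; rewrite addr0.
move=> [a [x' [sx' ->]]] [b [y' [sy' ->]]].
exists (a + b), (x' + y'); split; first exact: IHms.
by rewrite frobD; ring.
Qed.

Lemma pspanZ ms a x : pspan ms x -> pspan ms (a ^+ p * x).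
Proof.
elim: ms x => [|m ms IHms] x /=; first by move=> ->; rewrite mulr0.
move=> [b [x' [sx' ->]]]; exists (a * b), (a ^+ p * x'); split; first exact: IHms.
by rewrite exprMn; ring.
Qed.

Lemma pspan_mem ms m : m \in ms -> pspan ms m.
Proof.
elim: ms => [//|n ms IHms]; rewrite inE => /orP[/eqP ->|/IHms sm] /=.
  by exists 1, 0; split; [apply: pspan0|rewrite expr1n mul1r addr0].
exists 0, m; split=> //.
by rewrite frob0 mul0r add0r.
Qed.

Lemma pspan_min ms (P : set R) : P 0 -> (forall x y, P x -> P y -> P (x + y)) ->
  (forall a x, P x -> P (a ^+ p * x)) -> (forall m, m \in ms -> P m) ->
  pspan ms `<=` P.
Proof.
move=> P0 PD PZ; elim: ms => [_ x /= -> //|m ms IHms Pms x /=].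
move=> [a [y [sy ->]]]; apply: PD.
  by apply: PZ; apply: Pms; rewrite mem_head.
by apply: IHms sy => n nms; apply: Pms; rewrite inE nms orbT.
Qed.

(** A ring generated by finitely many elements over its [p]-th powers is a
    finite module over them: the monomials with all exponents below [p] span. *)
Lemma pspan_stable (gs : seq R) : exists2 ms, pspan ms 1 &
  forall g x, g \in gs -> pspan ms x -> pspan ms (g * x).
Proof.
elim: gs => [|h gs [ms ms1 stab]].
  by exists [:: 1] => //; apply: pspan_mem; rewrite mem_head.
pose ms' := [seq h ^+ e * m | e <- iota 0 p, m <- ms].
have mem' e x : (e < p)%N -> pspan ms x -> pspan ms' (h ^+ e * x).
  move=> lt_ep; move: x; apply: pspan_min.
  - by rewrite mulr0; apply: pspan0.
  - by move=> x y; rewrite mulrDr; apply: pspanD.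
  - by move=> a x; rewrite mulrCA; apply: pspanZ.
  - move=> m m_ms; apply: pspan_mem; apply/allpairsP.
    by exists (e, m); rewrite mem_iota.
have p_gt0 : (0 < p)%N by apply: ltnW.
exists ms' => [|g x].
  by rewrite -[1](mul1r 1) -[X in X * _](expr0 h); apply: mem'.
rewrite inE => g_hgs; move: x; apply: pspan_min.
- by rewrite mulr0; apply: pspan0.
- by move=> x y; rewrite mulrDr; apply: pspanD.
- by move=> a x; rewrite mulrCA; apply: pspanZ.
move=> _ /allpairsP[[e m] /= [+ m_ms ->]]; rewrite mem_iota add0n /= => lt_ep.
have sm := pspan_mem m_ms.
case/orP: g_hgs => [/eqP ->|g_gs]; last first.
  by rewrite mulrCA; apply: mem' => //; apply: stab.
rewrite mulrA -exprS; have [lt_e1p|] := ltnP e.+1 p; first exact: mem'.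
move=> le_pe; have -> : e.+1 = p by apply/eqP; rewrite eqn_leq lt_ep.
by apply: pspanZ; rewrite -[m]mul1r -[X in X * _](expr0 h); apply: mem'.
Qed.

(** * Compatibly split ideals *)

Variable phi : R -> R.
Hypothesis phi_split : frobenius_splitting p phi.

Let phiD a b : phi (a + b) = phi a + phi b.
Proof. by case: phi_split. Qed.

Let phiM a b : phi (a ^+ p * b) = a * phi b.
Proof. by case: phi_split. Qed.

Let phi1 : phi 1 = 1.
Proof. by case: phi_split. Qed.

Let phi0 : phi 0 = 0.
Proof. by apply: (addrI (phi 0)); rewrite -phiD !addr0. Qed.

Let phiN a : phi (- a) = - phi a.
Proof. by apply: (addrI (phi a)); rewrite -phiD !subrr. Qed.

Let phiK a : phi (a ^+ p) = a.
Proof. by rewrite -[a ^+ p]mulr1 phiM phi1 mulr1. Qed.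

Let phi_sum (T : Type) (r : seq T) (G : T -> R) :
  phi (\sum_(i <- r) G i) = \sum_(i <- r) phi (G i).
Proof. by apply: (big_morph phi). Qed.

Definition split_ideal I : Prop := is_ideal I /\ compatibly_split phi I.

Lemma split_idealP I x : split_ideal I -> I x -> I (phi x).
Proof. by move=> [_ cI] Ix; apply: cI; exists x. Qed.

(** [phi] extracts [p]-th roots inside [I]. *)
Lemma split_ideal_rad I x n : split_ideal I -> I (x ^+ n) -> I x.
Proof.
move=> sI; have [iI _] := sI.
have radp k : I (x ^+ (p ^ k)%N) -> I x.
  elim: k => [|k IHk]; first by rewrite expn0 expr1.
  by rewrite expnSr exprM => /(split_idealP sI); rewrite phiK.
move=> Ixn; apply: (radp n); have /ltnW/subnK <- := ltn_expl n p_gt1.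
by rewrite exprD; apply: idealM.
Qed.

Lemma split_ideal_zero : split_ideal [set 0].
Proof. by split; [apply: zero_ideal|move=> _ [x /= -> <-]]. Qed.

Lemma split_ideal_bigcap (P : set (set R)) :
  P `<=` split_ideal -> split_ideal (\bigcap_(I in P) I).
Proof.
move=> sP; split; first by apply: bigcap_ideal => I /sP[].
by move=> _ [x Px <-] I PI; apply: split_idealP (sP _ PI) (Px _ PI).
Qed.

Lemma split_ideal_add I J :
  split_ideal I -> split_ideal J -> split_ideal (ideal_add I J).
Proof.
move=> sI sJ; split; first by case: sI; case: sJ => *; apply: ideal_add_ideal.
move=> _ [_ [x Ix [y Jy <-]] <-]; rewrite phiD.
exists (phi x); first exact: split_idealP sI _.
by exists (phi y) => //; apply: split_idealP sJ _.
Qed.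

(** If [z * w] is in [J], so is [w ^+ p * z], and [phi] maps it to [w * phi z]. *)
Lemma split_ideal_colon J S : split_ideal J -> split_ideal (colon J S).
Proof.
move=> sJ; have [iJ _] := sJ; split; first exact: colon_ideal.
move=> _ [z Cz <-] w Sw; rewrite mulrC -phiM; apply: split_idealP sJ _.
rewrite exprp_gt1 -!mulrA [w * z]mulrC.
exact: idealM _ iJ (idealM _ iJ (Cz _ Sw)).
Qed.

(** * Test elements *)

(** Generic dual bases for the pairing [(x, y) |-> phi (x * y)], which is
    nondegenerate since [phi (x * x ^+ p.-1) = x]. Modulo [J] the remainder
    [T x := c ^+ p * x - ...] is [R^p]-linear and vanishes on the span treated
    so far. Given a new generator [m], either its remainder [y] is in [J], or
    [x |-> phi (T x * y ^+ p.-1)] kills the old span, takes the value [y] at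
    [m], and has the form [x |-> phi (x * d)]: then [d] is the new dual
    element, at the price of multiplying [c] by [y]. *)
Lemma dual_family J ms : split_ideal J -> prime_ideal J ->
  exists c (bd : seq (R * R)), ~ J c /\ forall x, pspan ms x ->
    J (c ^+ p * x - \sum_(u <- bd) phi (x * u.2) ^+ p * u.1).
Proof.
move=> sJ Jpr; have [iJ J1 Jp] := Jpr.
elim: ms => [|m ms [c [bd [Jc Tms]]]].
  exists 1, [::]; split=> // x /= ->.
  by rewrite mulr0 big_nil subr0; apply: ideal0.
pose T x := c ^+ p * x - \sum_(u <- bd) phi (x * u.2) ^+ p * u.1.
have TD a x : T (a ^+ p * m + x) = a ^+ p * T m + T x.
  rewrite /T mulrDr mulrBr big_distrr /= [RHS]addrACA -opprD -big_split /=.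
  rewrite mulrCA; congr (_ - _); apply: eq_bigr => u _.
  by rewrite mulrDl phiD -mulrA phiM frobD exprMn; ring.
have [Jy|Jy] := pselect (J (T m)).
  exists c, bd; split=> // _ [a [x [/Tms JTx ->]]].
  by rewrite -/(T _) TD; exact: idealD iJ (idealM _ iJ Jy) JTx.
move: (T m) TD Jy => y TD Jy.
pose z := y ^+ p.-1.
pose d := c ^+ p * z - \sum_(u <- bd) phi (u.1 * z) ^+ p * u.2.
have phid x : phi (x * d) = phi (T x * z).
  rewrite /d /T mulrBr mulrBl !phiD !phiN; congr (_ - _).
    by congr phi; ring.
  rewrite big_distrr big_distrl /= !phi_sum; apply: eq_bigr => u _.
  by rewrite mulrCA phiM -mulrA phiM mulrC.
clearbody d; pose bd' := (y, d) :: [seq (y ^+ p * u.1, u.2) | u <- bd].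
exists (y * c), bd'; split.
  by case/Jp.
move=> _ [a [x [/Tms JTx ->]]]; set x' := a ^+ p * m + x.
rewrite -/(T x) in JTx.
have -> : (y * c) ^+ p * x' - \sum_(u <- bd') phi (x' * u.2) ^+ p * u.1
    = y ^+ p * T x' - phi (x' * d) ^+ p * y.
  rewrite big_cons big_map /= /T mulrBr big_distrr /= exprMn -mulrA.
  rewrite opprD addrA addrAC; congr (_ - _ - _); apply: eq_bigr => u _; ring.
have -> : phi (x' * d) = a * y + phi (T x * z).
  rewrite phid TD mulrDl phiD -mulrA phiM -exprS prednK ?prime_gt0 //.
  by rewrite phiK.
have JTz : J (phi (T x * z)) by apply: (split_idealP sJ); apply: idealMr.
rewrite TD frobD exprMn.
have -> : y ^+ p * (a ^+ p * y + T x) - (a ^+ p * y ^+ p + phi (T x * z) ^+ p) * y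
    = y ^+ p * T x - phi (T x * z) ^+ p * y by ring.
apply: idealB => //; first exact: idealM.
by apply: idealMr => //; rewrite exprp_gt1; apply: idealM.
Qed.

(** Modulo [J], multiplication by [c] acts on the entries of [s] through a matrix
    [W] over [I]. The determinant of [c - W] kills these entries modulo [J], so it
    is in the prime [J], as some entry is not; modulo [I] it is [c ^+ size s]. *)
Lemma determinant_trick I J s c : prime_ideal J -> is_ideal I -> J `<=` I ->
  ~ ([set` s] `<=` J) ->
  (forall i : 'I_(size s), exists w : 'I_(size s) -> R,
     (forall k, I (w k)) /\ J (c * s`_i - \sum_k w k * s`_k)) ->
  I (c ^+ size s).
Proof.
move=> [iJ _ Jp] iI JI sJ /choice[w wP].
pose W : 'M[R]_(size s) := \matrix_(i, k) w i k.
pose v : 'cV[R]_(size s) := \col_i s`_i.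
have Jdet (i : 'I_(size s)) : J (\det (c%:M - W) * s`_i).
  have -> : \det (c%:M - W) * s`_i =
      (\adj (c%:M - W) *m ((c%:M - W) *m v)) i ord0.
    by rewrite mulmxA mul_adj_mx mul_scalar_mx !mxE.
  rewrite mxE; apply: ideal_sum => // k _; apply: idealM => //.
  have [_] := wP k; rewrite mulmxBl mul_scalar_mx !mxE.
  rewrite [in X in _ -> X](eq_bigr (fun l => w k l * s`_l)) // => l _.
  by rewrite !mxE.
have /existsNP[x /not_implyP[/= xs Jx]] := sJ.
have lt_xs : (index x s < size s)%N by rewrite index_mem.
have := Jdet (Ordinal lt_xs); rewrite nth_index // => /Jp[/JI Idet|/Jx //].
rewrite -det_scalar; apply: (ideal_subK iI _ Idet).
rewrite /determinant; pose eqI (x y : R) := I (x - y).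
apply: (big_ind2 eqI); rewrite /eqI ?subrr; first exact: ideal0.
  by move=> x1 x2 y1 y2 Ix Iy; rewrite opprD addrACA; apply: idealD.
move=> e _; rewrite -mulrBr; apply: idealM => //.
apply: (big_ind2 eqI); rewrite /eqI ?subrr; first exact: ideal0.
  move=> x1 x2 y1 y2 Ix Iy.
  have -> : x1 * y1 - x2 * y2 = y1 * (x1 - x2) + x2 * (y1 - y2) by ring.
  by apply: idealD => //; apply: idealM.
move=> i _; rewrite !mxE opprB addrCA subrr addr0.
by have [] := wP i.
Qed.

(** The test element of [R / J]. By the dual family, [c ^+ p * I] lies in the
    ideal generated by the [p]-th powers of elements of [I], up to [J], hence
    in [I ^ 2 + J]; the determinant trick and radicality of [I] conclude. *)
Lemma test_element J ms : noetherian R -> pspan ms = setT ->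
  split_ideal J -> prime_ideal J ->
  exists2 c, ~ J c &
    forall I, split_ideal I -> J `<=` I -> I <> J -> I c.
Proof.
move=> noethR msT sJ Jpr; have [iJ _ _] := Jpr.
have [c [bd [Jc Tms]]] := dual_family ms sJ Jpr.
exists (c ^+ p); first exact: prime_idealX.
move=> I sI JI neIJ; have [iI _] := sI.
have [s Is] := noethR _ iI.
apply: (split_ideal_rad (n := size s) sI).
apply: (determinant_trick Jpr iI JI).
  move=> sJ'; apply: neIJ; apply/seteqP; split=> //.
  by rewrite Is; apply: ideal_gen_min.
move=> i; have Isi : I s`_i.
  by rewrite Is; apply: mem_ideal_gen; rewrite /= mem_nth.
pose sq (x : R) := exists w : 'I_(size s) -> R,
  (forall k, I (w k)) /\ x = \sum_k w k * s`_k.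
suff [w [Iw Ew]] : sq (\sum_(u <- bd) phi (s`_i * u.2) ^+ p * u.1).
  by exists w; split=> //; rewrite -Ew; apply: Tms; rewrite msT.
apply: (big_ind sq).
- exists (fun=> 0); split=> [k|]; first exact: ideal0.
  by rewrite big1 // => k _; rewrite mul0r.
- move=> x y [w [Iw ->]] [w' [Iw' ->]]; exists (fun k => w k + w' k).
  split=> [k|]; first exact: idealD.
  by rewrite -big_split /=; apply: eq_bigr => k _; rewrite mulrDl.
- move=> u _; set h := phi _.
  have Ih : I h by apply: (split_idealP sI); apply: idealMr.
  have [r Er] : exists r : 'I_(size s) -> R, h = \sum_k r k * s`_k.
    by apply: ideal_gen_seqP; rewrite -Is.
  exists (fun k => h * (h ^+ p.-2 * u.1 * r k)); split=> [k|].
    exact: idealMr.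
  rewrite exprp_gt1 [in X in _ * X * _]Er big_distrr big_distrl /=.
  by apply: eq_bigr => k _; ring.
Qed.

(** * Finiteness of the set of compatibly split ideals *)

Definition split_above J : set (set R) := [set I | split_ideal I /\ J `<=` I].

(** For [z = x + a = y + b] with [x], [y] in [I], [a] in [J1] and [b] in [J2], the
    square of [z] is [a * b] modulo [I], and [a * b] is in [J]. *)
Lemma rad_meet_add I J J1 J2 : split_ideal I -> J `<=` I ->
  is_ideal J1 -> is_ideal J2 -> (forall x y, J1 x -> J2 y -> J (x * y)) ->
  ideal_add I J1 `&` ideal_add I J2 = I.
Proof.
move=> sI JI iJ1 iJ2 J12; have [iI _] := sI.
apply/seteqP; split=> [z|z Iz]; last by split; apply: ideal_addl.
move=> [[x Ix [a J1a Exa]] [y Iy [b J2b Eyb]]].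
apply: (split_ideal_rad (n := 2) sI); rewrite expr2.
have -> : z * z = z * x + a * y + a * b by rewrite -{2}Exa mulrDr -{2}Eyb; ring.
apply: idealD (JI _ (J12 _ _ J1a J2b)) => //.
by apply: idealD => //; apply: idealM.
Qed.

(** By Noetherian induction: maximality of [J] is used once for the two colon
    ideals that would witness that [J] is not prime, and once for the
    intersection of the compatibly split ideals strictly above [J], which the
    test element separates from [J]. *)
Theorem finite_split_ideals ms : noetherian R -> pspan ms = setT ->
  finite_set split_ideal.
Proof.
move=> noethR msT; pose bad J := split_ideal J /\ ~ finite_set (split_above J).
suff good J : split_ideal J -> finite_set (split_above J).
  apply: sub_finite_set (good _ split_ideal_zero) => I sI; split=> // x ->.
  by case: sI => /ideal0.
move=> sJ0; apply: contrapT => infJ0.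
have badid : bad `<=` (@is_ideal R) by move=> I [[]].
have [{sJ0 infJ0}J [sJ infJ] maxJ] :=
  noetherian_max noethR badid (conj sJ0 infJ0).
have [iJ _] := sJ.
have finJ I x : split_ideal I -> J `<=` I -> I x -> ~ J x ->
    finite_set (split_above I).
  move=> sI JI Ix Jx; apply: contrapT => infI.
  by rewrite (maxJ I) in Ix.
have Jpr : prime_ideal J.
  split=> //.
    move=> J1; apply: infJ; apply: (sub_finite_set (B := [set setT])) => //.
    move=> I [[iI _] JI] /=; apply/seteqP; split=> // x _.
    by rewrite -[x]mulr1; apply: idealM (JI _ J1).
  move=> x y Jxy; apply: contrapT => /not_orP[Jx Jy]; apply: infJ.
  pose J1 := colon J [set x]; pose J2 := colon J J1.
  have sJ1 : split_ideal J1 by apply: split_ideal_colon.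
  have sJ2 : split_ideal J2 by apply: split_ideal_colon.
  have fin1 : finite_set (split_above J1).
    by apply: (finJ _ y) => //; [apply: sub_colon|move=> _ ->; rewrite mulrC].
  have fin2 : finite_set (split_above J2).
    apply: (finJ _ x) => //; first exact: sub_colon.
    by move=> w; rewrite mulrC; apply.
  apply: sub_finite_set (finite_image2 setI fin1 fin2) => I [sI JI].
  have [[iI _] [iJ1 _] [iJ2 _]] := And3 sI sJ1 sJ2.
  exists (ideal_add I J1).
    by split; [apply: split_ideal_add|apply: ideal_addr].
  exists (ideal_add I J2).
    by split; [apply: split_ideal_add|apply: ideal_addr].
  apply: (@rad_meet_add _ J) => // a b J1a J2b.
  by rewrite mulrC; exact: (J2b a J1a).
have [c Jc testc] := test_element noethR msT sJ Jpr.
pose above := split_above J `\ J; pose J' := \bigcap_(I in above) I.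
have fin' : finite_set (split_above J').
  apply: (finJ _ c) => //.
  - by apply: split_ideal_bigcap => I [[]].
  - by move=> x Jx I [[_ JI] _]; apply: JI.
  - by move=> I [[sI JI] neIJ]; apply: testc.
apply: infJ; apply: (sub_finite_set (B := [set J] `|` split_above J')).
  move=> I [sI JI]; have [->|neIJ] := pselect (I = J); [by left|right].
  by split=> // x; apply; split.
by rewrite finite_setU.
Qed.

End Splitting.

(** * Graded rings *)

Section GradedRing.
Set Implicit Arguments.
Unset Strict Implicit.
Unset Printing Implicit Defensive.
Variables (F : fieldType) (p : nat) (R : comAlgType F) (gr : nat -> set R).
Hypotheses (perfF : perfect_field_of_char F p) (noethR : noetherian R).
Hypothesis gradedR : is_grading gr.

Let gr0 n : gr n 0.
Proof. by case: (grading_submod gradedR n). Qed.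

Let grD n x y : gr n x -> gr n y -> gr n (x + y).
Proof.
have [_ grL] := grading_submod gradedR n.
by move=> /grL grxy /(grxy 1); rewrite scale1r.
Qed.

(** Homogeneous generators of the ideal of positive degree elements generate
    [R] as an algebra, by induction on the degree; and [R_0 = F] consists of
    [p]-th powers. *)
Lemma graded_pspan : exists ms : seq R, pspan p ms = setT.
Proof.
have [charF rootF] := perfF.
have charR : p \in [pchar R] by rewrite pchar_lalg.
pose pos : set R := \bigcup_(n in [set n | (0 < n)%N]) gr n.
have [gs gs_pos gs_gen] := noetherian_gen pos noethR.
have [ms ms1 stab] := pspan_stable charR gs.
exists ms; apply/seteqP; split=> // x _.
suff grN n : gr n `<=` pspan p ms.
  have [c [N [grc ->]]] := grading_span gradedR x.
  apply: (big_ind (pspan p ms)); first exact: pspan0.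
    by move=> *; apply: pspanD.
  by move=> i _; apply: grN.
elim/ltn_ind: n {x} => n IHn x grx.
have [n0|n_gt0] := posnP n.
  move: grx; rewrite n0 (grading_zero gradedR) => -[a _ <-].
  have [b <-] := rootF a.
  have -> : (b ^+ p)%:A = b%:A ^+ p * 1 :> R by rewrite exprZn expr1n mulr1.
  exact: pspanZ.
(* [D] is stable under sums and contains every multiple of a generator: degrees
   at most [n] of such a multiple involve only coefficients of degree below [n].
   So [x] is in [D], and it is its own component of degree [n]. *)
pose D : set R := [set z | exists (c : nat -> R) (K : nat),
  [/\ forall k, gr k (c k), forall k, (K <= k)%N -> c k = 0,
      forall k, (k <= n)%N -> pspan p ms (c k)
    & z = \sum_(k < K) c k]].
have widen (c : nat -> R) K K' : (K <= K')%N ->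
    (forall k, (K <= k)%N -> c k = 0) -> \sum_(k < K) c k = \sum_(k < K') c k.
  move=> leK c0; rewrite (big_ord_widen K' c leK) big_mkcond /=.
  by apply: eq_bigr => k _; case: ltnP => // /c0.
have DD y z : D y -> D z -> D (y + z).
  move=> [c [K [grc c0 sc ->]]] [c' [K' [grc' c'0 sc' ->]]].
  exists (fun k => c k + c' k), (maxn K K'); split.
  - by move=> k; apply: grD.
  - by move=> k; rewrite geq_max => /andP[/c0 -> /c'0 ->]; rewrite addr0.
  - by move=> k lekn; apply: pspanD => //; [apply: sc|apply: sc'].
  - rewrite big_split /= (widen _ K (maxn K K')) ?leq_maxl //.
    by rewrite (widen _ K' (maxn K K')) ?leq_maxr.
have DM r g : g \in gs -> D (r * g).
  move=> ggs; have [d /= d_gt0 grg] := gs_pos g ggs.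
  have [c [N [grc ->]]] := grading_span gradedR r.
  exists (fun k => if (d <= k < d + N)%N then c (k - d)%N * g else 0), (d + N)%N.
  split.
  - move=> k; case: ifP => // /andP[ledk _]; rewrite -{1}(subnK ledk).
    exact: grading_mul.
  - by move=> k leNk; rewrite [(k < _)%N]ltnNge leNk andbF.
  - move=> k lekn; case: ifP => [/andP[ledk _]|_]; last exact: pspan0.
    rewrite mulrC; apply: stab => //; apply: (IHn (k - d)%N) => //.
    apply: leq_trans lekn; rewrite ltn_subrL d_gt0.
    exact: leq_trans d_gt0 ledk.
  - rewrite big_split_ord /= [X in _ = X + _]big1 => [|i _]; last first.
      by rewrite leqNgt ltn_ord.
    rewrite add0r big_distrl /=; apply: eq_bigr => i _.
    by rewrite leq_addr ltn_add2l ltn_ord /= addKn.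
have [c [K [grc c0 spanc Ex]]] : D x.
  have [|r ->] := @ideal_gen_seqP _ gs x.
    by apply: gs_gen; apply: mem_ideal_gen; exists n.
  apply: (big_ind D) => //; last by move=> i _; apply: DM; rewrite mem_nth.
  exists (fun=> 0), 0%N; split=> //; last by rewrite big_ord0.
  by move=> k _; apply: pspan0.
suff /eqP : c n - x = 0 by rewrite subr_eq0 => /eqP <-; apply: spanc.
pose K' := maxn K n.+1; have ltnK' : (n < K')%N by rewrite leq_maxr.
pose e k := c k - (if k == n then x else 0).
have gre k : gr k (e k).
  have [_ grL] := grading_submod gradedR k.
  rewrite /e -scaleN1r addrC; apply: grL => //.
  by case: eqP => // ->.
suff e0 : \sum_(k < K') e k = 0.
  by have := grading_free gradedR gre e0 (Ordinal ltnK'); rewrite /e /= eqxx.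
rewrite big_split /= sumrN -(widen _ K) ?leq_maxl // -Ex.
rewrite (bigD1 (Ordinal ltnK')) //= eqxx big1 ?addr0 ?subrr //.
by move=> k; rewrite -val_eqE /= => /negPf ->.
Qed.

End GradedRing.

Theorem corollary1 (F : fieldType) (p : nat) (R : comAlgType F)
  (gr : nat -> set R) (phi : R -> R) (f : {poly rat})
  (perfF : perfect_field_of_char F p)
  (noethR : noetherian R)
  (gradedR : is_grading gr)
  (splitR : graded_splitting gr p phi) :
  finite_set [set I | hilbert_points gr f I /\ compatibly_split phi I].
Proof.
have [frobR _ _] := splitR.
have charR : p \in [pchar R] by rewrite pchar_lalg; case: perfF.
have [ms msT] := graded_pspan perfF noethR gradedR.
apply: sub_finite_set (finite_split_ideals charR frobR noethR msT).
by move=> I [[[idI _] _ _] splitI].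
Qed.
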